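(* Let $\alpha\notin\mathbb{Q}$, let $\beta\notin\mathbb{Q}$ with $0<\beta<1$, and let $N$ be a prime number. Let $Rx=x+\alpha$ modulo $1$ on $[0,1[$, let $f(x)=1$ if $x\in[0,\beta[$ and $f(x)=0$ if $x\in[\beta,1[$, and for $g\in\{f,1-f\}$ let $T_g(x,s)=(Rx,s+g(x))$ on $[0,1[\times\mathbb{Z}/N\mathbb{Z}$. Then: (1) $T_f$ is not minimal if and only if $\beta=m\alpha+n$ for some $m\in N\mathbb{Z}$, $n\in N\mathbb{Z}$; (2) $T_{1-f}$ is not minimal if and only if $\beta=m\alpha+n+1$ for some $m\in N\mathbb{Z}$, $n\in N\mathbb{Z}$.
   Context: Intervals are semi-open: $[a,b[\,=\{x: a\le x<b\}$. The values of $f$ and $1-f$ are taken in $\mathbb{Z}/N\mathbb{Z}$. A transformation is minimal if every orbit is dense; here $[0,1[\times\{s\}$ carries the usual topology of the interval (equivalently, identify it with $[s,s+1[$, so that $T_f$ is an interval exchange transformation on $[0,N[$). *)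

(* Defs.v *)
From mathcomp Require Import all_boot all_order all_algebra.
From mathcomp Require Import all_classical all_reals all_analysis.
From mathcomp Require Import lra.

Set Implicit Arguments.
Unset Strict Implicit.
Unset Printing Implicit Defensive.

Import Order.TTheory GRing.Theory Num.Theory.
Import numFieldNormedType.Exports.

Local Open Scope classical_set_scope.
Local Open Scope ring_scope.

(* The sigma type of [0, 1[, carrying the topology induced from R. *)
Definition unit_co (R : realType) : Type := set_type (`[(0 : R), 1[%classic).

Lemma frac_part_co (R : realType) (x : R) :
  x - (Num.floor x)%:~R \in (`[(0 : R), 1[%classic).
Proof.
apply/mem_set; rewrite /= in_itv /=; apply/andP; split.
  by rewrite subr_ge0 floor_le.
have := floorD1_gt x; rewrite intrD; lra.
Qed.

Definition frac_part (R : realType) (x : R) : unit_co R :=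
  exist _ (x - (Num.floor x)%:~R) (frac_part_co x).

Definition rotation (R : realType) (alpha : R) (x : unit_co R) : unit_co R :=
  frac_part (sval x + alpha).

(* [0, 1[ x Z/N with the product topology, Z/N being discrete: it has
   the same dense subsets as [0, N[ cut into the pieces [s, s + 1[.
   Meaningful for 1 < N only, since 'Z_0 and 'Z_1 are 'Z_2. *)
Definition phase_space (R : realType) (N : nat) : Type :=
  (unit_co R * discrete_topology 'Z_N)%type.

Definition indic_co (R : realType) (N : nat) (beta : R) (x : unit_co R) :
    'Z_N :=
  if sval x < beta then 1 else 0.

Definition skew_product (R : realType) (N : nat) (alpha : R)
    (g : unit_co R -> 'Z_N) (p : phase_space R N) : phase_space R N :=
  (rotation alpha p.1, (p.2 : 'Z_N) + g p.1).

(* Two-sided orbit {T^n x : n in Z}, for a bijection T. *)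
Definition full_orbit (X : Type) (T : X -> X) (x : X) : set X :=
  [set y | exists n : nat, iter n T x = y \/ iter n T y = x].

Definition minimal_map (X : topologicalType) (T : X -> X) : Prop :=
  forall x : X, dense (full_orbit T x).

Lemma rotationK (R : realType) (alpha : R) :
  cancel (rotation alpha) (rotation (- alpha)).
Proof.
move=> x; apply/val_inj => /=.
set k := Num.floor (sval x + alpha).
have -> : sval x + alpha - k%:~R - alpha = sval x + (- k)%:~R.
  by rewrite intrN; lra.
have /= := set_mem (svalP x); rewrite in_itv /= => /andP[x0 x1].
have -> : Num.floor (sval x + (- k)%:~R) = - k.
  by apply/eqP; rewrite floor_eq intrD intrN; apply/andP; split; lra.
by rewrite addrK.
Qed.

Lemma skew_product_bij (R : realType) (N : nat) (alpha : R)
    (g : unit_co R -> 'Z_N) :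
  bijective (skew_product alpha g).
Proof.
exists (fun p : phase_space R N => (rotation (- alpha) p.1,
  (p.2 : 'Z_N) - g (rotation (- alpha) p.1)) : phase_space R N) => -[x s].
  by rewrite /skew_product /= rotationK addrK.
by rewrite /skew_product /= subrK -{1}(opprK alpha) rotationK.
Qed.

(* Main.v *)
Require Import Defs.
From mathcomp Require Import all_boot all_order all_algebra.
From mathcomp Require Import all_classical all_reals all_analysis.
From mathcomp Require Import lra ring zify.

Set Implicit Arguments.
Unset Strict Implicit.
Unset Printing Implicit Defensive.

Import Order.TTheory GRing.Theory Num.Theory.
Import numFieldNormedType.Exports.

Local Open Scope classical_set_scope.
Local Open Scope ring_scope.

(** The rotation R and the function g are lifted to the line: g becomes a
1-periodic function, and [0, 1[ is given the topology whose basic open sets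
are the intervals [a, b[.  Non-empty open sets for this finer topology contain
non-empty open sets for the usual one, so minimality is unaffected, and T_g
becomes a homeomorphism that acts by translation on the fibres.

Non-minimality amounts to a cohomological equation
([not_minimal_coboundary], [coboundary_not_minimal]): T_g fails to be minimal
exactly when g(x) = h(x + alpha) - h(x) for some 1-periodic
h : R -> Z/N that is constant on a right neighbourhood of every point.  Given
h, the function s - h(x) is invariant, and one of its level sets contains an
open set that misses an orbit.  Conversely, let an orbit O be non-dense and let
W(x) be the set of s such that (y, s) is not in O for all y >= x close to x.
The cardinal of W(x) can only grow from x to nearby points on its right and is
invariant under rotation; since orbits of the rotation come back to every right
neighbourhood, it is a constant k, so W is constant on right neighbourhoods.
Here 0 < k < N, hence k is invertible modulo the prime N, and h(x) can be taken
to be the sum of the elements of W(x) divided by k.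

It remains to solve the cohomological equation for
F_c(x) = floor(x) - floor(x - c), which is the indicator function f for
c = beta and the opposite of 1 - f for c = beta - 1.  With
values in any non-zero ring A, F_c is a coboundary if and only if
c = m alpha + n with m and n null in A ([floor_step_coboundary]).  Two facts
give this.  First, a discontinuity of h propagates forward along its
orbit until it meets a discontinuity of g, for otherwise it would accumulate on
its own right side, where h is constant; the same holds backward
([jump_forward], [jump_backward]).  So either h is constant on [0, 1[, which
forces c to be an integer, or the discontinuities 0 and c of F_c lie on
the same orbit: in both cases c = m alpha + n.  Second, F_(m alpha + n) differs
from n - m F_(- alpha) by an explicit coboundary ([floor_step_mulz]), and the
discontinuities 0 and - alpha of the latter are consecutive on their orbit, so
that a transfer function h can only jump at integers: h is constant on
[0, 1[, hence n - m F_(- alpha) is null in A, and since F_(- alpha) takes two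
consecutive values, so are m and n. *)

(** * Orbits of an irrational rotation *)

Lemma irrational_mulz (R : realType) (alpha : R) (j k : int) :
  irrational alpha -> j%:~R * alpha = k%:~R -> j = 0.
Proof.
move=> irr E; apply/eqP/negPn/negP => j0; apply: irr.
exists (k%:Q / j%:Q) => //; rewrite fmorph_div !rmorph_int -E.
by field; rewrite intr_eq0.
Qed.

Lemma irrational_mulz_add (R : realType) (alpha : R) (x : R) (i j : int) :
  irrational alpha -> x + i%:~R * alpha \is a Num.int ->
  x + j%:~R * alpha \is a Num.int -> i = j.
Proof.
move=> irr /intrP[a ea] /intrP[b eb]; apply/eqP; rewrite -subr_eq0; apply/eqP.
apply: (irrational_mulz (k := a - b) irr).
by rewrite !intrB -ea -eb; ring.
Qed.

(** Pigeonhole: among the fractional parts of j alpha for 0 <= j <= M, two lie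
in the same cell of length 1 / M < e. *)
Lemma orbit_close (R : realType) (alpha e : R) :
  irrational alpha -> 0 < e ->
  exists (n : nat) (k : int), [/\ (0 < n)%N &
    `|n%:R * alpha + k%:~R| < e].
Proof.
move=> irr e0.
pose M := (Num.truncn e^-1).+1.
have Me : 1 < M%:R * e by rewrite -ltr_pdivrMr // mul1r; apply: truncnS_gt.
pose fr (j : nat) : R := j%:R * alpha - (Num.floor (j%:R * alpha))%:~R.
have fr0 j : 0 <= fr j by rewrite /fr subr_ge0 floor_le.
have fr1 j : fr j < 1.
  by have := floorD1_gt (j%:R * alpha); rewrite /fr intrD; lra.
have cellP (j : nat) : (Num.truncn (M%:R * fr j) < M)%N.
  rewrite truncn_lt_nat ?mulr_ge0 //.
  by rewrite -[ltRHS]mulr1 ltr_pM2l ?fr1 // ltr0n.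
pose cell (j : 'I_M.+1) : 'I_M := Ordinal (cellP j).
have : ~~ injectiveb cell.
  apply/negP => /injectiveP /leq_card; rewrite !card_ord; lia.
case/injectivePn => i [j ij /(congr1 val) /= eij].
wlog ltij : i j ij eij / (i < j)%N.
  move=> wl; case: (ltngtP i j) => [lt|lt|/val_inj E]; first exact: (wl i j).
  - by apply: (wl j i) => //; rewrite eq_sym.
  - by rewrite E eqxx in ij.
exists (j - i)%N, (Num.floor (i%:R * alpha) - Num.floor (j%:R * alpha)).
split; first by rewrite subn_gt0.
have -> : (j - i)%:R * alpha
    + (Num.floor (i%:R * alpha) - Num.floor (j%:R * alpha))%:~R = fr j - fr i.
  by rewrite /fr intrB natrB ?(ltnW ltij) //; ring.
have /andP[ai bi] : (Num.truncn (M%:R * fr i))%:R <= M%:R * fr i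
    < (Num.truncn (M%:R * fr i)).+1%:R.
  by apply: truncn_itv; rewrite mulr_ge0.
have /andP[aj bj] : (Num.truncn (M%:R * fr j))%:R <= M%:R * fr j
    < (Num.truncn (M%:R * fr j)).+1%:R.
  by apply: truncn_itv; rewrite mulr_ge0.
rewrite -eij -natr1 in aj bj; rewrite -natr1 in bi.
have M0 : 0 < M%:R :> R by rewrite ltr0n.
have : `|M%:R * fr j - M%:R * fr i| < 1 by rewrite ltr_norml; apply/andP; split; lra.
rewrite -mulrBr normrM gtr0_norm // => lt1.
by rewrite -(ltr_pM2l M0); lra.
Qed.

(** When the close return d of [orbit_close] is negative, the sequence 1 + t d
decreases by steps smaller than e and cannot vanish, so its last positive term
lies in ]0, e[. *)
Lemma small_return (R : realType) (alpha e : R) :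
  irrational alpha -> 0 < e ->
  exists (n : nat) (k : int), 0 < n%:R * alpha + k%:~R < e.
Proof.
move=> irr e0; have [n [k [n0]]] := orbit_close irr e0.
set d := _ + _ => de.
have [d0|d0|d0] := ltgtP d 0; last first.
- have := irrational_mulz (j := n%:Z) (k := - k) irr; rewrite intrN.
  have -> : n%:~R * alpha = - k%:~R :> R by move: d0; rewrite /d; lra.
  by move/(_ erefl); case: (n) n0.
- by exists n, k; rewrite -/d d0 /=; move: de; rewrite ltr_norml => /andP[].
have nd0 : 0 < - d by rewrite oppr_gt0.
pose t := Num.truncn (- d)^-1.
have /andP[t1 t2] : t%:R <= (- d)^-1 < t.+1%:R.
  by apply: truncn_itv; rewrite invr_ge0 ltW.
have t1' : t%:R * - d <= 1 by rewrite -ler_pdivlMr // mul1r.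
have t2' : 1 < t.+1%:R * - d by rewrite -ltr_pdivrMr // mul1r.
exists (t * n)%N, (1 + t%:Z * k).
have -> : (t * n)%:R * alpha + (1 + t%:Z * k)%:~R = 1 + t%:R * d.
  by rewrite /d intrD intrM natrM; ring.
apply/andP; split; last first.
  by move: de t2'; rewrite ltr0_norm // -natr1; lra.
rewrite lt_def; apply/andP; split; last by lra.
apply/eqP => E.
have F : (t * n)%:Z%:~R * alpha = (- (1 + t%:Z * k))%:~R.
  by move: E; rewrite /d intrN intrD intrM -pmulrn natrM; lra.
have := irrational_mulz irr F.
case: (t) E => [|t']; first by rewrite mul0r addr0 => /eqP; rewrite oner_eq0.
by case: (n) n0.
Qed.

Lemma orbit_hits (R : realType) (alpha x y e : R) :
  irrational alpha -> 0 < e ->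
  exists (n : nat) (k : int), y < x + (n%:R * alpha + k%:~R) < y + e.
Proof.
move=> irr e0; have [n [k]] := small_return irr e0.
set d := _ + _ => /andP[d0 de].
pose K := Num.floor (y - x).
have K0 : 0 <= y - x - K%:~R by rewrite subr_ge0 floor_le.
pose t := Num.truncn ((y - x - K%:~R) / d).
have /andP[t1 t2] : t%:R <= (y - x - K%:~R) / d < t.+1%:R.
  by apply: truncn_itv; rewrite divr_ge0 // ltW.
move: t1 t2; rewrite ler_pdivlMr // ltr_pdivrMr // => t1 t2.
exists (t.+1 * n)%N, (t.+1%:Z * k + K).
have -> : (t.+1 * n)%:R * alpha + (t.+1%:Z * k + K)%:~R = t.+1%:R * d + K%:~R.
  by rewrite /d intrD intrM natrM; ring.
by move: t1 t2; rewrite -natr1 mulrDl mul1r => t1 t2; apply/andP; split; lra.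
Qed.

(** * Locally constant functions on the line *)

(** Continuity with a discrete codomain for the topology of the line generated
by the intervals [a, b[. *)
Definition right_loc_const (R : realType) (T : Type) (h : R -> T) :=
  forall x, exists2 e, 0 < e & forall y, x <= y < x + e -> h y = h x.

Definition loc_const_at (R : realType) (T : Type) (h : R -> T) (x : R) :=
  exists2 e, 0 < e & forall y, `|y - x| < e -> h y = h x.

Definition periodic1 (R : realType) (T : Type) (h : R -> T) :=
  forall x, h (x + 1) = h x.

Lemma periodic1z (R : realType) (T : Type) (h : R -> T) x (k : int) :
  periodic1 h -> h (x + k%:~R) = h x.
Proof.
move=> per; have pern y (n : nat) : h (y + n%:R) = h y.
  by elim: n => [|n IH]; rewrite ?addr0 // -natr1 addrA per.
case: k => n; first exact: pern.
by rewrite NegzE intrN -(pern _ n.+1) subrK.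
Qed.

Lemma right_loc_const_op (R : realType) (T U V : Type) (op : T -> U -> V)
    (h : R -> T) (k : R -> U) :
  right_loc_const h -> right_loc_const k ->
  right_loc_const (fun x => op (h x) (k x)).
Proof.
move=> rh rk x; have [e e0 he] := rh x; have [d d0 hd] := rk x.
exists (Num.min e d); first by rewrite lt_min e0.
move=> y /andP[xy]; rewrite -ltrBlDl lt_min => /andP[ye yd].
by rewrite he ?hd // xy -ltrBlDl.
Qed.

Lemma right_loc_const_shift (R : realType) (T : Type) (h : R -> T) (c : R) :
  right_loc_const h -> right_loc_const (fun x => h (x + c)).
Proof.
move=> rh x; have [e e0 he] := rh (x + c); exists e => // y xy.
by apply: he; lra.
Qed.

Lemma loc_const_at_op (R : realType) (T U V : Type) (op : T -> U -> V)
    (h : R -> T) (k : R -> U) x :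
  loc_const_at h x -> loc_const_at k x ->
  loc_const_at (fun x => op (h x) (k x)) x.
Proof.
move=> [e e0 he] [d d0 hd].
exists (Num.min e d); first by rewrite lt_min e0.
by move=> y; rewrite lt_min => /andP[ye yd]; rewrite he ?hd.
Qed.

Lemma loc_const_at_comp (R : realType) (T U : Type) (p : T -> U)
    (h : R -> T) x :
  loc_const_at h x -> loc_const_at (fun x => p (h x)) x.
Proof. by move=> [e e0 he]; exists e => // y /he ->. Qed.

Lemma loc_const_at_shift (R : realType) (T : Type) (h : R -> T) (x c : R) :
  loc_const_at (fun x => h (x + c)) x <-> loc_const_at h (x + c).
Proof.
split=> -[e e0 he]; exists e => // y ye; last first.
  by apply: he; rewrite opprD addrACA subrr addr0.
by rewrite -[y](subrK c) he //; move: ye; rewrite opprD addrA addrAC.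
Qed.

Lemma floor_right_loc_const (R : realType) :
  right_loc_const (Num.floor : R -> int).
Proof.
move=> x; exists ((Num.floor x + 1)%:~R - x).
  by rewrite subr_gt0 floorD1_gt.
move=> y /andP[xy yx]; apply: floor_def; apply/andP; split; last by lra.
by apply: le_trans xy; apply: floor_le.
Qed.

Lemma floor_loc_const (R : realType) (x : R) :
  x \isn't a Num.int -> loc_const_at (Num.floor : R -> int) x.
Proof.
move=> xZ; have lx : (Num.floor x)%:~R < x.
  rewrite lt_neqAle floor_le andbT; apply: contra xZ => /eqP <-.
  exact: intr_int.
have := floorD1_gt x => gx.
exists (Num.min (x - (Num.floor x)%:~R) ((Num.floor x + 1)%:~R - x)).
  by rewrite lt_min !subr_gt0 lx.
move=> y; rewrite lt_min !ltr_norml => /andP[/andP[a b] /andP[c d]].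
by apply: floor_def; apply/andP; split; lra.
Qed.

(** The infimum of the points where h differs from h 0 would have to be a
discontinuity of h. *)
Lemma constant_on_co (R : realType) (T : Type) (h : R -> T) :
  right_loc_const h -> (forall x, 0 < x < 1 -> loc_const_at h x) ->
  forall x, 0 <= x < 1 -> h x = h 0.
Proof.
move=> rh lh x /andP[x0 x1]; apply: contrapT => hx.
pose B := [set y | 0 <= y < 1 /\ h y <> h 0].
have B0 : has_inf B.
  by split; [exists x; split => //; rewrite x0 | exists 0 => y [/andP[]]].
have bx : inf B <= x by apply: ge_inf; [case: B0 | split; rewrite ?x0].
have b0 : 0 <= inf B by apply: lb_le_inf; [case: B0 | move=> y [/andP[]]].
have below y : 0 <= y < inf B -> h y = h 0.
  move=> /andP[y0 yb]; apply: contrapT => hy.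
  suff : inf B <= y by lra.
  by apply: ge_inf; [case: B0 | split => //; rewrite y0 /=; lra].
have hb : h (inf B) = h 0.
  case: (ltgtP 0 (inf B)) b0 => [b0 _|//|<- //].
  have [|e e0 he] := lh (inf B); first by rewrite b0; lra.
  have [ge|lt] := leP (inf B - e / 2) 0.
    by rewrite -(he 0) // ltr_norml; apply/andP; split; lra.
  rewrite -(he (inf B - e / 2)); last by rewrite ltr_norml; apply/andP; split; lra.
  by apply: below; apply/andP; split; lra.
have [e e0 he] := rh (inf B).
suff : inf B + e <= inf B by lra.
apply: lb_le_inf; first by case: B0.
move=> y [/andP[y0 y1] hy]; rewrite leNgt; apply/negP => ye; apply: hy.
have [by'|yb] := leP (inf B) y; first by rewrite he // by'.
by apply: below; rewrite y0.
Qed.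

(** * Propagation of the discontinuities of a transfer function *)

(** Where g is locally constant, h jumps at y + alpha as soon as it jumps at y.
If g were locally constant along the whole forward orbit of x, h would then jump at
points of this orbit that return, modulo 1, arbitrarily close to x on its right,
where h is constant. *)
Lemma jump_forward (R : realType) (V : zmodType) (alpha : R) (h g : R -> V) x :
  irrational alpha -> right_loc_const h -> periodic1 h ->
  (forall x, h (x + alpha) = h x + g x) -> ~ loc_const_at h x ->
  exists n : nat, ~ loc_const_at g (x + n%:R * alpha).
Proof.
move=> irr rh ph hg nx; apply: contrapT => /forallNP ng.
have {}ng (n : nat) : loc_const_at g (x + n%:R * alpha) by apply: contrapT.
have nh (n : nat) : ~ loc_const_at h (x + n%:R * alpha).
  elim: n => [|n IH]; first by rewrite mul0r addr0.
  rewrite -natr1 mulrDl mul1r addrA => lh; apply: IH.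
  have E : h = fun y => h (y + alpha) - g y.
    by apply/funext => y; rewrite hg addrK.
  rewrite E; apply: (loc_const_at_op (fun a b => a - b)) (ng n).
  exact/loc_const_at_shift.
have [e e0 he] := rh x.
have [n [k /andP[xd dx]]] := orbit_hits x x irr e0.
apply: (nh n); rewrite addrA in xd dx.
set y := _ + n%:R * _ in xd dx *.
exists (Num.min (y + k%:~R - x) (x + e - (y + k%:~R))).
  by rewrite lt_min !subr_gt0 xd.
move=> z; rewrite lt_min !ltr_norml => /andP[/andP[a b] /andP[c d]].
by rewrite -(periodic1z z k ph) -(periodic1z y k ph) !he //; apply/andP; split; lra.
Qed.

(** For the rotation by - alpha, h is a transfer function of x |-> - g (x - alpha);
this shift makes the index start at 1, so that the backward orbit is disjoint
from the one in [jump_forward]. *)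
Lemma jump_backward (R : realType) (V : zmodType) (alpha : R) (h g : R -> V) x :
  irrational alpha -> right_loc_const h -> periodic1 h ->
  (forall x, h (x + alpha) = h x + g x) -> ~ loc_const_at h x ->
  exists n : nat, ~ loc_const_at g (x - n.+1%:R * alpha).
Proof.
move=> irr rh ph hg nx.
have irrN : irrational (- alpha).
  by move=> [q _ qE]; apply: irr; exists (- q) => //; rewrite rmorphN /= qE opprK.
have [|n] := @jump_forward R V (- alpha) h (fun x => - g (x - alpha)) x irrN rh ph _ nx.
  by move=> y; have := hg (y - alpha); rewrite subrK => ->; rewrite addrK.
rewrite mulrN => ng; exists n => lg; apply: ng.
apply: (loc_const_at_comp (-%R)).
apply/loc_const_at_shift.
by move: lg; rewrite -natr1 mulrDl mul1r opprD addrA.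
Qed.

(** * The cohomological equation for interval indicators *)

Definition coboundary (R : realType) (V : zmodType) (alpha : R) (g : R -> V) :=
  exists h : R -> V, [/\ right_loc_const h, periodic1 h &
    forall x, h (x + alpha) = h x + g x].

Lemma coboundaryD (R : realType) (V : zmodType) (alpha : R) (g k : R -> V) :
  coboundary alpha g -> coboundary alpha k ->
  coboundary alpha (fun x => g x + k x).
Proof.
move=> [u [ru pu hu]] [v [rv pv hv]]; exists (fun x => u x + v x); split.
- exact: right_loc_const_op.
- by move=> x; rewrite pu pv.
- by move=> x; rewrite hu hv addrACA.
Qed.

Lemma coboundaryN (R : realType) (V : zmodType) (alpha : R) (g : R -> V) :
  coboundary alpha g -> coboundary alpha (fun x => - g x).
Proof.
move=> [u [ru pu hu]]; exists (fun x => - u x); split.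
- exact: (right_loc_const_op (fun a _ => - a) ru ru).
- by move=> x; rewrite pu.
- by move=> x; rewrite hu opprD.
Qed.

Lemma coboundary0 (R : realType) (V : zmodType) (alpha : R) (g : R -> V) :
  (forall x, g x = 0) -> coboundary alpha g.
Proof.
move=> g0; exists (fun=> 0); split=> // x; last by rewrite g0 addr0.
by exists 1.
Qed.

(** For 0 < c < 1 this is the 1-periodic extension of the indicator function of
[0, c[; written with floors, it makes sense for every c and satisfies
F_(c + c')(x) = F_c(x) + F_c'(x - c). *)
Definition floor_step (R : realType) (c x : R) : int :=
  Num.floor x - Num.floor (x - c).

Lemma floorDz (R : realType) (x : R) (k : int) :
  Num.floor (x + k%:~R) = Num.floor x + k.
Proof. by rewrite floorDrz ?intr_int // intrKfloor. Qed.

Lemma floor_step_periodic (R : realType) (c : R) : periodic1 (floor_step c).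
Proof.
move=> x; rewrite /floor_step addrAC.
by have /= := (floorDz x 1, floorDz (x - c) 1) => -[-> ->]; ring.
Qed.

Lemma floor_step_right_loc_const (R : realType) (c : R) :
  right_loc_const (floor_step c).
Proof.
apply: (right_loc_const_op (fun a b => a - b)).
  exact: floor_right_loc_const.
exact: (right_loc_const_shift (- c) (@floor_right_loc_const R)).
Qed.

Lemma floor_step_jump (R : realType) (T : Type) (p : int -> T) (c x : R) :
  ~ loc_const_at (fun y => p (floor_step c y)) x ->
  x \is a Num.int \/ x - c \is a Num.int.
Proof.
move=> nl; apply: contrapT => /not_orP[/negP xZ /negP xcZ]; apply: nl.
apply: loc_const_at_comp; apply: (loc_const_at_op (fun a b => a - b)).
  exact: floor_loc_const.
by apply/(loc_const_at_shift _ _ (- c)); apply: floor_loc_const.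
Qed.

(** The jump at t, the fractional part of c, has size 1. *)
Lemma floor_step_two_values (R : realType) (c : R) : c \isn't a Num.int ->
  exists2 t, 0 <= t < 1 & floor_step c 0 = floor_step c t + 1.
Proof.
move=> cZ; pose t := c - (Num.floor c)%:~R; exists t.
  by have := set_mem (frac_part_co c); rewrite /= in_itv.
rewrite /floor_step.
have -> : Num.floor t = 0 by rewrite /t -intrN floorDz subrr.
have -> : t - c = 0 + (- Num.floor c)%:~R by rewrite /t intrN; ring.
have -> : Num.floor (0 - c) = - Num.floor c - 1.
  rewrite sub0r; apply: floor_def; rewrite subrK intrB !intrN.
  have gt := floorD1_gt c; rewrite intrD in gt.
  have : (Num.floor c)%:~R < c.
    rewrite lt_neqAle floor_le andbT.
    by apply: contra cZ => /eqP <-; exact: intr_int.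
  by move=> lt; apply/andP; split; lra.
by rewrite floorDz floor0; ring.
Qed.

(** By induction on m.  The increment F_((m + 1) alpha) - F_(m alpha) is
- F_(- alpha) translated by (m + 1) alpha; a function and its translate by a
multiple of alpha differ by a coboundary, here that of - F_((m + 1) alpha). *)
Lemma floor_step_mulz (R : realType) (A : pzRingType) (alpha : R) (m : int) :
  coboundary alpha (fun x => (floor_step (m%:~R * alpha) x
                              + m * floor_step (- alpha) x)%:~R : A).
Proof.
have step (j : int) : coboundary alpha (fun x =>
   (floor_step ((j + 1)%:~R * alpha) x - floor_step (j%:~R * alpha) x
     + floor_step (- alpha) x)%:~R : A).
  exists (fun x => (- floor_step ((j + 1)%:~R * alpha) x)%:~R); split.
  - have F := @floor_step_right_loc_const R ((j + 1)%:~R * alpha).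
    exact: (right_loc_const_op (fun a _ => (- a)%:~R) F F).
  - by move=> x; rewrite floor_step_periodic.
  - move=> x; rewrite -intrD /floor_step; congr (_%:~R).
    rewrite opprK intrD.
    have -> : x + alpha - (j%:~R + 1%:~R) * alpha = x - j%:~R * alpha by ring.
    by ring.
have ext (g k : R -> A) : g =1 k -> coboundary alpha g -> coboundary alpha k.
  by move=> /funext ->.
elim: m => [|m IH|m IH].
- by apply: coboundary0 => x; rewrite /floor_step mul0r subr0 mul0r addr0 subrr.
- apply: ext (coboundaryD IH (step m)) => x.
  by rewrite -intrD; congr (_%:~R); rewrite -addn1 PoszD; ring.
- apply: ext (coboundaryD IH (coboundaryN (step (- m.+1%:Z)))) => x.
  rewrite -intrN -intrD; congr (_%:~R).
  have -> : - m.+1%:Z + 1 = - m%:Z by lia.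
  by rewrite -addn1 PoszD; ring.
Qed.

Lemma floor_step_addz (R : realType) (c x : R) (n : int) :
  floor_step (c + n%:~R) x = floor_step c x + n.
Proof.
by rewrite /floor_step opprD addrA -intrN floorDz; ring.
Qed.

(** The discontinuities 0 and - alpha of F_(- alpha) are consecutive on their
orbit, so a transfer function jumps at integers only and is constant on
[0, 1[. *)
Lemma coboundary_affine (R : realType) (A : nzRingType) (alpha : R)
    (m n : int) : irrational alpha ->
  coboundary alpha (fun x => (n - m * floor_step (- alpha) x)%:~R : A) ->
  m%:~R = 0 :> A /\ n%:~R = 0 :> A.
Proof.
move=> irr [h [rh ph hg]].
have lh x : 0 < x < 1 -> loc_const_at h x.
  move=> x01; apply: contrapT => nh.
  have [i] := jump_forward irr rh ph hg nh.
  move=> /(floor_step_jump (p := fun a => (n - m * a)%:~R)); rewrite opprK => Hi.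
  have [j] := jump_backward irr rh ph hg nh.
  move=> /(floor_step_jump (p := fun a => (n - m * a)%:~R)); rewrite opprK => Hj.
  (* Whichever discontinuity is met, the orbit of x passes through an integer
     at some time a >= 0 and at some time - b <= 0, which must coincide. *)
  have [a Ha] : exists a : nat, x + a%:Z%:~R * alpha \is a Num.int.
    case: Hi => Hi; first by exists i.
    by exists i.+1; move: Hi; rewrite -addrA -[i.+1%:Z%:~R]natr1 mulrDl mul1r.
  have [b Hb] : exists b : nat, x + (- b%:Z)%:~R * alpha \is a Num.int.
    case: Hj => Hj; first by exists j.+1; move: Hj; rewrite intrN mulNr.
    exists j; move: Hj; rewrite intrN mulNr -[j.+1%:R]natr1 mulrDl mul1r.
    by rewrite opprD addrA subrK.
  have ab := irrational_mulz_add irr Ha Hb.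
  have a0 : a = 0%N by lia.
  move: Ha; rewrite a0 mul0r addr0 => /intrP[k xk].
  move: x01; rewrite xk -[0]/(0%:~R) -[1]/(1%:~R) !ltr_int; lia.
have hc := constant_on_co rh lh.
have g0 x : 0 <= x < 1 -> (n - m * floor_step (- alpha) x)%:~R = 0 :> A.
  move=> x01; apply: (addrI (h x)); rewrite -hg addr0.
  rewrite -(periodic1z _ (- Num.floor (x + alpha)) ph) !hc // intrN.
  by have := set_mem (frac_part_co (x + alpha)); rewrite /= in_itv.
have aZ : - alpha \isn't a Num.int.
  apply/negP; rewrite rpredN => /intrP[k ak].
  by have := irrational_mulz (j := 1) (k := k) irr; rewrite mul1r => /(_ ak).
have [t t01 ht] := floor_step_two_values aZ.
have z0 : 0 <= (0 : R) < 1 by rewrite lexx ltr01.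
have m0 : m%:~R = 0 :> A.
  have := g0 _ t01; have := g0 _ z0; rewrite ht => E1 E2.
  rewrite (_ : m = (n - m * floor_step (- alpha) t)
                  - (n - m * (floor_step (- alpha) t + 1))); last by ring.
  by rewrite intrB E1 E2 subrr.
split=> //; have := g0 _ z0; rewrite intrB intrM m0 mul0r subr0; exact.
Qed.

(** The existence of m and n comes from the position of the discontinuities of a
transfer function; their nullity in A then follows by reduction to
[coboundary_affine]. *)
Theorem floor_step_coboundary (R : realType) (A : nzRingType) (alpha c : R) :
  irrational alpha ->
  coboundary alpha (fun x => (floor_step c x)%:~R : A) <->
  exists m n : int, [/\ m%:~R = 0 :> A, n%:~R = 0 :> A &
    c = m%:~R * alpha + n%:~R].
Proof.
move=> irr.
have red (m n : int) x : (floor_step (m%:~R * alpha + n%:~R) x)%:~R =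
    (floor_step (m%:~R * alpha) x + m * floor_step (- alpha) x)%:~R
    + (n - m * floor_step (- alpha) x)%:~R :> A.
  by rewrite -intrD floor_step_addz; congr (_%:~R); ring.
split=> [cob|[m [n [m0 n0 ->]]]]; last first.
  under [X in coboundary _ X]funext => x do rewrite red.
  apply: coboundaryD; first exact: floor_step_mulz.
  by apply: coboundary0 => x; rewrite intrB intrM m0 n0 mul0r subrr.
suff [m [n cE]] : exists m n : int, c = m%:~R * alpha + n%:~R.
  exists m, n.
  suff [] : m%:~R = 0 :> A /\ n%:~R = 0 :> A by split.
  apply: (coboundary_affine irr).
  have := coboundaryD cob (coboundaryN (floor_step_mulz A alpha m)).
  congr coboundary; apply/funext => x.
  by rewrite cE red addrAC subrr add0r.
have [h [rh ph hg]] := cob.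
have [lh|] := pselect (forall x, 0 < x < 1 -> loc_const_at h x).
  have hc := constant_on_co rh lh.
  have g0 x : 0 <= x < 1 -> (floor_step c x)%:~R = 0 :> A.
    move=> x01; apply: (addrI (h x)); rewrite -hg addr0.
    rewrite -(periodic1z _ (- Num.floor (x + alpha)) ph) !hc // intrN.
    by have := set_mem (frac_part_co (x + alpha)); rewrite /= in_itv.
  have [/intrP[n ->]|cZ] := boolP (c \is a Num.int).
    by exists 0, n; rewrite mul0r add0r.
  have [t t01 ht] := floor_step_two_values cZ.
  have := g0 0; rewrite lexx ltr01 ht intrD g0 // add0r => /(_ isT) /eqP.
  by rewrite oner_eq0.
move=> /existsNP[x /not_implyP[_ nh]].
have [i] := jump_forward irr rh ph hg nh.
move=> /(floor_step_jump (p := fun a => a%:~R)) Hi.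
have [j] := jump_backward irr rh ph hg nh.
move=> /(floor_step_jump (p := fun a => a%:~R)) Hj.
(* The forward and backward orbits of x cannot meet the same discontinuity. *)
have same y : y + i%:R * alpha \is a Num.int ->
    y - j.+1%:R * alpha \is a Num.int -> i%:Z = - j.+1%:Z.
  move=> yi yj; apply: (irrational_mulz_add (x := y) irr) => //.
  by rewrite intrN mulNr.
case: Hi => Hi; case: Hj => Hj.
- by have := same _ Hi Hj; lia.
- have /intrP[k kE] := rpredB Hi Hj.
  exists (- (i + j.+1)%:Z), k; rewrite -kE intrN -pmulrn natrD; ring.
- have /intrP[k kE] := rpredB Hi Hj.
  exists (i + j.+1)%:Z, (- k); rewrite intrN -kE -pmulrn natrD; ring.
- have := same (x - c).
  by rewrite addrAC => /(_ Hi); rewrite addrAC => /(_ Hj); lia.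
Qed.

(** * Non-minimality as a cohomological equation *)

Lemma frac_partDz (R : realType) (x : R) (k : int) :
  frac_part (x + k%:~R) = frac_part x.
Proof. by apply/val_inj => /=; rewrite floorDz intrD; ring. Qed.

Lemma frac_part_sval (R : realType) (u : unit_co R) : frac_part (sval u) = u.
Proof.
apply/val_inj => /=; have := set_mem (svalP u); rewrite /= in_itv /= => u01.
by rewrite (_ : Num.floor _ = 0) ?subr0 //; apply: floor_def.
Qed.

Lemma sval_frac_part (R : realType) (x : R) : 0 <= x < 1 ->
  sval (frac_part x) = x.
Proof.
by move=> x01 /=; rewrite (_ : Num.floor _ = 0) ?subr0 //; apply: floor_def.
Qed.

Lemma rotation_frac_part (R : realType) (alpha x : R) :
  rotation alpha (frac_part x) = frac_part (x + alpha).
Proof. by rewrite /rotation /= addrAC -intrN frac_partDz. Qed.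

Lemma full_orbit_invariant (X : Type) (T : X -> X) (p q : X) : injective T ->
  full_orbit T p (T q) <-> full_orbit T p q.
Proof.
move=> injT; split=> -[n [E|E]].
- case: n E => [|n] /= E; first by exists 1%N; right.
  by exists n; left; apply: injT.
- by exists n.+1; right; rewrite iterSr.
- by exists n.+1; left; rewrite /= E.
- case: n E => [|n] E; first by exists 1%N; left; rewrite /= -E.
  by exists n; right; rewrite -iterSr.
Qed.

Lemma open_phase_box (R : realType) (N : nat) (U : set (phase_space R N))
    (x : unit_co R) (s : 'Z_N) : open U -> U (x, s) ->
  exists2 e, 0 < e & forall y : unit_co R, `|sval y - sval x| < e -> U (y, s).
Proof.
move=> oU Uxs.
have : nbhs ((x, s) : phase_space R N) U by apply: open_nbhs_nbhs.
move=> [[A B] [/= nA nB] AB].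
move: nA; rewrite nbhsE => -[_ [[C oC <-] Cx] CA].
have : nbhs (sval x) C by apply: open_nbhs_nbhs.
move=> /nbhs_ballP[e /= e0 eC]; exists e => // y ye.
apply: AB; split => /=; last exact: nbhs_singleton nB.
by apply: CA; apply: eC; rewrite /ball /= distrC.
Qed.

Lemma open_phase_itv (R : realType) (N : nat) (a b : R) (s : 'Z_N) :
  open ([set p | a < sval p.1 < b /\ p.2 = s] : set (phase_space R N)).
Proof.
have -> : [set p | a < sval p.1 < b /\ p.2 = s] =
  ((fun p : phase_space R N => sval p.1) @^-1` `]a, b[%classic)
    `&` ((fun p : phase_space R N => p.2) @^-1` [set s]).
  by apply/seteqP; split=> p /=; rewrite in_itv.
apply: openI.
  apply: open_comp; last exact: itv_open.
  move=> p _; apply: cvg_comp; first exact: cvg_fst.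
  exact: (@initial_continuous (unit_co R) R sval).
apply: open_comp; last exact: discrete_open.
by move=> p _; exact: cvg_snd.
Qed.

Lemma right_nbhs_forall (R : realType) (I : eqType) (P : I -> R -> Prop) (x : R)
    (s : seq I) :
  (forall i, exists2 e, 0 < e & forall y, x <= y < x + e -> P i y) ->
  exists2 e, 0 < e & forall y, x <= y < x + e -> forall i, i \in s -> P i y.
Proof.
move=> H; elim: s => [|i s [e e0 he]]; first by exists 1.
have [d d0 hd] := H i.
exists (Num.min e d); first by rewrite lt_min e0.
move=> y /andP[xy]; rewrite -ltrBlDl lt_min !ltrBlDl => /andP[ye yd] j.
by rewrite inE => /predU1P[->|/he]; [apply: hd | apply]; rewrite xy.
Qed.

(** The function (x, s) |-> s - h x is invariant; it vanishes on the orbit of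
(0, h 0) and equals 1 on ]0, b[ x {h 0 + 1}, an open set when h is constant on
[0, b[. *)
Lemma coboundary_not_minimal (R : realType) (alpha : R) (N : nat)
    (g : unit_co R -> 'Z_N) :
  coboundary alpha (fun x => g (frac_part x)) ->
  ~ minimal_map (skew_product alpha g).
Proof.
move=> [h [rh ph hg]] /(_ (frac_part 0, h 0 : 'Z_N)) dns.
have [e e0 he] := rh 0; rewrite add0r in he.
pose b := Num.min e 1; have b0 : 0 < b by rewrite lt_min e0 ltr01.
have [be b1] : b <= e /\ b <= 1 by split; rewrite ge_min lexx ?orbT.
pose inv (p : phase_space R N) : 'Z_N := (p.2 : 'Z_N) - h (sval p.1).
have hfrac x : h (sval (frac_part x)) = h x by rewrite /= -intrN periodic1z.
have invT p : inv (skew_product alpha g p) = inv p.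
  by rewrite /inv /= [h (_ - _)]hfrac hg frac_part_sval; ring.
have invn n p : inv (iter n (skew_product alpha g) p) = inv p.
  by elim: n => [//|n IH]; rewrite iterS invT.
have half : 0 < b / 2 < b by apply/andP; split; lra.
have [] := dns _ _ (@open_phase_itv R N 0 b (h 0 + 1)).
  exists (frac_part (b / 2), h 0 + 1); split => //.
  by rewrite sval_frac_part //; apply/andP; split; lra.
move=> [u s] [[/andP[u0 ub] /= ->] orb].
have : inv (u, h 0 + 1) = inv (frac_part 0, h 0).
  by case: orb => n [] <-; rewrite invn.
rewrite /inv [X in _ = _ - X]hfrac /= subrr (he (sval u)); last by apply/andP; split; lra.
by rewrite addrAC subrr add0r => /eqP; rewrite oner_eq0.
Qed.

(** The fibres W x of the interior of the complement of a non-dense orbit (for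
the topology of right neighbourhoods) have a constant cardinal k with
0 < k < N.  Rotation translates W x by g x, hence adds k g x to the sum of its
elements: dividing by k solves the equation. *)
Lemma not_minimal_coboundary (R : realType) (alpha : R) (N : nat)
    (g : unit_co R -> 'Z_N) :
  irrational alpha -> prime N -> right_loc_const (fun x => g (frac_part x)) ->
  ~ minimal_map (skew_product alpha g) ->
  coboundary alpha (fun x => g (frac_part x)).
Proof.
move=> irr prN rg /existsNP[p].
move=> /existsNP[U /not_implyP[U0 /not_implyP[oU UO]]].
set O := full_orbit _ _ in UO.
have OT q : O (skew_product alpha g q) <-> O q.
  by apply: full_orbit_invariant; apply: bij_inj; exact: skew_product_bij.
pose free (x : R) (s : 'Z_N) := exists2 e, 0 < e &
  forall y, x <= y < x + e -> ~ O (frac_part y, s).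
pose W (x : R) : {set 'Z_N} := [set s | `[< free x s >]]%SET.
have inW x s : s \in W x <-> free x s.
  by rewrite inE; split => [/asboolP|/asboolP].
have Wper : periodic1 W.
  move=> x; apply/setP => s; apply/idP/idP => /inW[e e0 he]; apply/inW;
    exists e => // y ye.
    by rewrite -(frac_partDz y 1); apply: he; lra.
  by rewrite -(frac_partDz y (-1)) intrN; apply: he; lra.
have Wup x : exists2 e, 0 < e & forall y, x <= y < x + e -> W x \subset W y.
  have [s|e e0 he] := @right_nbhs_forall R _
    (fun s y => s \in W x -> s \in W y) x (enum 'Z_N).
    have [/inW[e e0 he]|ns] := boolP (s \in W x); last by exists 1.
    exists e => // y /andP[xy ye] _; apply/inW; exists (x + e - y).
      by rewrite subr_gt0.
    by move=> z /andP[yz ze]; apply: he; lra.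
  exists e => // y ye; apply/fintype.subsetP => s.
  by apply: he => //; rewrite mem_enum.
have Wshift x : W (x + alpha) = [set s + g (frac_part x) | s in W x]%SET.
  have [d d0 hd] := rg x.
  have OTx y s : O (frac_part (y + alpha), s + g (frac_part y)) <->
      O (frac_part y, s).
    by rewrite -rotation_frac_part; exact: (OT (frac_part y, s)).
  apply/setP => s; apply/idP/imsetP => [/inW[e e0 he]|[t /inW[e e0 he] ->]].
    exists (s - g (frac_part x)); last by rewrite subrK.
    apply/inW; exists (Num.min e d); first by rewrite lt_min e0.
    move=> y /andP[xy]; rewrite -ltrBlDl lt_min !ltrBlDl => /andP[ye yd].
    move/OTx; rewrite hd ?xy // subrK; apply: he; lra.
  apply/inW; exists (Num.min e d); first by rewrite lt_min e0.
  move=> y /andP[xy]; rewrite -ltrBlDl lt_min !ltrBlDl => /andP[ye yd].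
  rewrite -(subrK alpha y) -(hd (y - alpha)); last by lra.
  by move/OTx; apply: he; lra.
have Wcard_alpha x : #|W (x + alpha)| = #|W x|.
  by rewrite Wshift card_imset //; exact: addIr.
(* The orbit of y enters a right neighbourhood of x on which W contains W x. *)
have Wcard_le x y : (#|W x| <= #|W y|)%N.
  have [e e0 he] := Wup x.
  have [n [k]] := orbit_hits y x irr e0; rewrite addrA => /andP[xz zx].
  have -> : #|W y| = #|W (y + n%:R * alpha + k%:~R)|.
    rewrite periodic1z //; elim: (n) => [|m IH]; first by rewrite mul0r addr0.
    by rewrite -natr1 mulrDl mul1r addrA Wcard_alpha.
  by apply: subset_leq_card; apply: he; rewrite ltW.
have Wcard x : #|W x| = #|W 0|.
  by apply/eqP; rewrite eqn_leq !Wcard_le.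
have rW : right_loc_const W.
  move=> x; have [e e0 he] := Wup x; exists e => // y ye.
  by apply/esym/eqP; rewrite eqEcard he //= !Wcard.
(* W is not empty above the first coordinate of a point of U, and does not
   contain s above u if p = (u, s). *)
have Wpos : (0 < #|W 0%R|)%N.
  have [[u s] Uus] := U0; have [e e0 he] := open_phase_box oU Uus.
  rewrite -(Wcard (sval u)) card_gt0; apply/set0Pn; exists s; apply/inW.
  have := set_mem (svalP u); rewrite /= in_itv /= => /andP[u0 u1].
  exists (Num.min e (1 - sval u)); first by rewrite lt_min e0 subr_gt0.
  move=> y /andP[uy]; rewrite -ltrBlDl lt_min => /andP[ye y1] Oy.
  apply: UO; exists (frac_part y, s); split => //; apply: he.
  rewrite sval_frac_part ?ger0_norm ?subr_ge0 //; apply/andP; split; lra.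
have Wlt : (#|W 0%R| < N)%N.
  rewrite -(Wcard (sval p.1)) -[X in (_ < X)%N](@Zp_cast N) ?prime_gt1 //.
  rewrite -[X in (_ < X)%N]card_ord -cardsT; apply: proper_card.
  apply/properP; split; first exact: finset.subsetT.
  exists p.2; first by rewrite finset.in_setT.
  apply/negP => /inW[e e0 /(_ (sval p.1))]; rewrite lexx ltrDl e0 => /(_ isT).
  by rewrite frac_part_sval -surjective_pairing; apply; exists 0%N; left.
set k := #|W 0%R| in Wpos Wlt Wcard.
have ku : (k%:R : 'Z_N) \is a GRing.unit.
  rewrite unitZpE ?prime_gt1 // prime_coprime //.
  by rewrite gtnNdvd.
exists (fun x => (\sum_(s in W x) s) / k%:R); split.
- exact: (right_loc_const_op (fun (A : {set 'Z_N}) _ => (\sum_(s in A) s) / k%:R) rW rW).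
- by move=> x; rewrite Wper.
- move=> x; rewrite Wshift big_imset /=; last by move=> a b _ _; exact: addIr.
  rewrite big_split /= sumr_const Wcard mulrDl -(mulr_natr (g _)) mulrK //.
Qed.

(** * The minimality criterion *)

Lemma indic_co_floor_step (R : realType) (N : nat) (beta x : R) :
  0 < beta < 1 -> indic_co N beta (frac_part x) = (floor_step beta x)%:~R.
Proof.
move=> /andP[b0 b1]; rewrite -[in RHS](subrK (Num.floor x)%:~R x).
rewrite (periodic1z _ _ (floor_step_periodic beta)) /indic_co /=.
set t := x - _.
have := set_mem (frac_part_co x); rewrite /= in_itv /= -/t => /andP[t0 t1].
rewrite /floor_step (@floor_def _ t 0) ?t0 //.
case: ltP => tb.
  by rewrite (@floor_def _ (t - beta) (-1)) //; apply/andP; split; lra.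
by rewrite (@floor_def _ (t - beta) 0) //; apply/andP; split; lra.
Qed.

(** Both signs are allowed because 1 - f is the opposite of F_(beta - 1). *)
Theorem not_minimal_floor_step (R : realType) (N : nat) (alpha c : R)
    (g : unit_co R -> 'Z_N) :
  irrational alpha -> prime N ->
  (forall x, g (frac_part x) = (floor_step c x)%:~R) \/
  (forall x, g (frac_part x) = - (floor_step c x)%:~R) ->
  ~ minimal_map (skew_product alpha g) <->
  exists m n : int, [/\ (N%:Z %| m)%Z, (N%:Z %| n)%Z &
    c = m%:~R * alpha + n%:~R].
Proof.
move=> irr prN gE.
have rF : right_loc_const (fun x => (floor_step c x)%:~R : 'Z_N).
  have F := @floor_step_right_loc_const R c.
  exact: (right_loc_const_op (fun a _ => a%:~R) F F).
have rg : right_loc_const (fun x => g (frac_part x)).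
  case: gE => /funext ->; first exact: rF.
  exact: (right_loc_const_op (fun a _ => - a) rF rF).
have cobE : coboundary alpha (fun x => g (frac_part x)) <->
    coboundary alpha (fun x => (floor_step c x)%:~R : 'Z_N).
  case: gE => /funext -> //; split=> /coboundaryN //.
  by under eq_fun do rewrite opprK.
have NZ : N \in [pchar 'Z_N].
  by rewrite inE prN pchar_Zp ?prime_gt1 ?eqxx.
have dvdE (m : int) : (N%:Z %| m)%Z <-> m%:~R = 0 :> 'Z_N.
  by rewrite (dvdz_pcharf NZ); split=> /eqP.
split=> [nm|[m [n [/dvdE m0 /dvdE n0 cE]]]].
  have /cobE/(floor_step_coboundary _ _ irr)[m [n [m0 n0 cE]]] :=
    not_minimal_coboundary irr prN rg nm.
  by exists m, n; split=> //; apply/dvdE.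
apply/coboundary_not_minimal/cobE/(floor_step_coboundary _ _ irr).
by exists m, n.
Qed.

Theorem theorem1 (R : realType) (alpha beta : R) (N : nat)
    (halpha : irrational alpha) (hbeta : irrational beta)
    (hbeta01 : 0 < beta < 1) (hN : prime N) :
  (~ minimal_map (skew_product alpha (@indic_co R N beta)) <->
     exists m n : int, [/\ (N%:Z %| m)%Z, (N%:Z %| n)%Z &
       beta = m%:~R * alpha + n%:~R]) /\
  (~ minimal_map (skew_product alpha (fun x => 1 - @indic_co R N beta x)) <->
     exists m n : int, [/\ (N%:Z %| m)%Z, (N%:Z %| n)%Z &
       beta = m%:~R * alpha + n%:~R + 1]).
Proof.
split.
  by apply: not_minimal_floor_step => //; left=> x; exact: indic_co_floor_step.
rewrite (@not_minimal_floor_step _ _ _ (beta - 1)) //; last first.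
  right=> x; rewrite indic_co_floor_step // -[beta - 1]/(beta + (-1)%:~R).
  by rewrite floor_step_addz intrD intrN opprD opprK addrC.
split=> -[m [n [Nm Nn E]]]; exists m, n; split=> //; first by rewrite -E subrK.
by rewrite E addrK.
Qed.
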